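(* (Christoffel–Darboux formulae.) Let $\mu$ be a quasi-definite complex Borel measure on $\mathbb{T}^D$, let $n=(n_{-1},\dots,n_{-D},n_D,\dots,n_1)^\top\in\mathbb{C}^{2D}$, $L_n(z)=\sum_{a=1}^D(n_{-a}z_a^{-1}+n_az_a)$, $\nu=\sum_{a=1}^D(n_{-a}\Upsilon_a^{-1}+n_a\Upsilon_a)$, and let $K^{(k)}(z_1,z_2)=\sum_{l=0}^{k-1}\hat\phi_{[l]}(z_1)^\dagger H_{[l]}^{-1}\phi_{[l]}(z_2)$. Then for $k\ge1$ and $z_1,z_2\in(\mathbb{C}^* )^D$ with $L_n(z_2)\neq L_n(\bar z_1^{-1})$, $$K^{(k)}(z_1,z_2)=\frac{\hat\phi_{[k-1]}(z_1)^\dagger H_{[k-1]}^{-1}\nu_{[k-1],[k]}\phi_{[k]}(z_2)-\hat\phi_{[k]}(z_1)^\dagger\nu_{[k],[k-1]}H_{[k-1]}^{-1}\phi_{[k-1]}(z_2)}{L_n(z_2)-L_n(\bar z_1^{-1})}$$ $$=\frac{\phi_{[k-1]}(\bar z_1^{-1})^\top (H_{[k-1]}^\top)^{-1}(\eta\nu)_{[k-1],[k]}\phi_{[k]}(z_2)-\phi_{[k]}(\bar z_1^{-1})^\top(\eta\nu)_{[k],[k-1]}H_{[k-1]}^{-1}\phi_{[k-1]}(z_2)}{L_n(z_2)-L_n(\bar z_1^{-1})}$$ $$=\frac{\hat\phi_{[k-1]}(z_1)^\dagger H_{[k-1]}^{-1}(\nu\eta)_{[k-1],[k]}\bar{\hat\phi}_{[k]}(z_2^{-1})-\hat\phi_{[k]}(z_1)^\dagger(\nu\eta)_{[k],[k-1]}(H_{[k-1]}^\top)^{-1}\bar{\hat\phi}_{[k-1]}(z_2^{-1})}{L_n(z_2)-L_n(\bar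 z_1^{-1})}.$$
   Context: Let $D\ge1$, $z(\theta)=(e^{i\theta_1},\dots,e^{i\theta_D})$. For $\alpha\in\mathbb{Z}^D$ put $|\alpha|=\sum_a|\alpha_a|$, $z^\alpha=\prod_a z_a^{\alpha_a}$, $[k]=\{\alpha:|\alpha|=k\}$. Multi-indices are ordered by $|\alpha|$ and lexicographically inside each $[k]$; $\chi(z)$ is the semi-infinite column of all monomials $z^\alpha$ in this order. Semi-infinite matrices have the corresponding block structure $A_{[k],[l]}$, and $A^{[k]}$ denotes truncation to blocks $0,\dots,k-1$. The moment matrix is $G=\oint_{\mathbb{T}^D}\chi(z(\theta))d\mu(\theta)\chi(z(\theta))^\dagger$. The measure is quasi-definite if $\det G^{[k]}\ne0$ for all $k\ge1$; then uniquely $G=S^{-1}H(\hat S^{-1})^\dagger$ with $S,\hat S$ block lower unitriangular and $H=\operatorname{diag}(H_{[0]},H_{[1]},\dots)$ block diagonal with invertible blocks. $\Phi=S\chi$, $\hat\Phi=\hat S\chi$ have blocks $\phi_{[k]},\hat\phi_{[k]}$. The spectral matrices have entries $(\Upsilon_a)_{\beta,\gamma}=\delta_{\beta+e_a,\gamma}$, with $\Upsilon_a^{-1}=\Upsilon_a^\top$. The reversal matrix is $\eta_{\alpha,\beta}=\delta_{\alpha,-\beta}$. $\bar{\hat\phi}_{[k]}(z)$ is obtained from $\hat\phi_{[k]}(z)$ by conjugating only its coefficients; for $z\in(\mathbb{C}^* )^D$, $z^{-1}$ and $\bar z^{-1}$ are taken componentwise. *)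

(* Defs.v *)
From HB Require Import structures.
From mathcomp Require Import all_boot all_order all_algebra.
From mathcomp Require Import complex zify.
From mathcomp Require Import all_classical all_reals all_analysis.

Set Implicit Arguments.
Unset Strict Implicit.
Unset Printing Implicit Defensive.
Set SsrOldRewriteGoalsOrder.

Import Order.TTheory GRing.Theory Num.Theory.
Import numFieldNormedType.Exports.

Local Open Scope classical_set_scope.
Local Open Scope ring_scope.
Local Open Scope sesquilinear_scope.

(* A complex measure is a charge with values in \bar R[i]: charges are finite
   on measurable sets, so this is a countably additive R[i]-valued function. *)
Section complex_measure_parts.
Context d (T : measurableType d) (R : realType).
Variable mu : {charge set T -> \bar R[i]}.

Definition re_part (A : set T) : \bar R := (complex.Re (fine (mu A)))%:E.
Definition im_part (A : set T) : \bar R := (complex.Im (fine (mu A)))%:E.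

Let part_sigma_additive (p : {additive R[i] -> R}) :
    (forall x : R[i], (`|p x|%:C)%C <= `|x|) ->
  semi_sigma_additive (fun A : set T => (p (fine (mu A)))%:E).
Proof.
move=> lep F mF tF mUF.
have /fine_cvgP[_ muF] : (fun n => \sum_(0 <= i < n) mu (F i))%E @ \oo -->
    ((fine (mu (\bigcup_n F n)))%:E : \bar R[i]).
  rewrite fineK ?fin_num_measure//; exact: (@charge_semi_sigma_additive _ _ _ mu).
apply: (@cvg_EFin R); first by near=> n; rewrite sumEFin.
have -> : fine \o (fun n => \sum_(0 <= i < n) (p (fine (mu (F i))))%:E)%E =
          p \o (fine \o (fun n => \sum_(0 <= i < n) mu (F i))%E).
  apply/funext => n /=; rewrite sumEFin/= -raddf_sum; congr (p _).
  transitivity (fine ((\sum_(0 <= i < n) fine (mu (F i)))%:E)) => //.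
  rewrite -sumEFin; congr fine; apply: eq_bigr => i _.
  by rewrite fineK ?fin_num_measure.
apply/cvgrPdist_lt => e e0 /=.
have e0C : 0 < (e%:C)%C :> R[i] by rewrite ltcR.
move/cvgrPdist_lt : muF => /(_ _ e0C); apply: filterS => n /= ln.
by rewrite -raddfB -ltcR; apply: le_lt_trans ln.
Unshelve. all: by end_near. Qed.

Let norm_Re_le (x : R[i]) : (`|complex.Re x|%:C)%C <= `|x|.
Proof. exact: normc_ge_Re. Qed.

Let norm_Im_le (x : R[i]) : (`|complex.Im x|%:C)%C <= `|x|.
Proof.
have -> : complex.Im x = - complex.Re (x * 'i%C) by rewrite ReiNIm opprK.
by rewrite normrN; apply: le_trans (normc_ge_Re _) _; rewrite normrM [`|'i%C|]normc_def /=
  expr0n expr1n add0r sqrtr1 mulr1.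
Qed.

Let re_part0 : re_part set0 = 0%E. Proof. by rewrite /re_part charge0. Qed.
Let im_part0 : im_part set0 = 0%E. Proof. by rewrite /im_part charge0. Qed.

HB.instance Definition _ := isCharge.Build _ _ _ re_part
  re_part0 (fun _ _ => isT) (part_sigma_additive norm_Re_le).
HB.instance Definition _ := isCharge.Build _ _ _ im_part
  im_part0 (fun _ _ => isT) (part_sigma_additive norm_Im_le).

End complex_measure_parts.

Section complex_integral.
Context d (T : measurableType d) (R : realType).

Definition hahn_pos (nu : {charge set T -> \bar R}) : set T :=
  projT1 (cid (Hahn_decomposition nu)).
Definition hahn_neg (nu : {charge set T -> \bar R}) : set T :=
  projT1 (cid (projT2 (cid (Hahn_decomposition nu)))).

Lemma hahnP (nu : {charge set T -> \bar R}) :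
  hahn_decomposition nu (hahn_pos nu) (hahn_neg nu).
Proof. exact: projT2 (cid (projT2 (cid (Hahn_decomposition nu)))). Qed.

(* The Jordan decomposition does not depend on the chosen Hahn decomposition. *)
Definition integral_charge (nu : {charge set T -> \bar R}) (f : T -> R) : R :=
  \int[jordan_pos (hahnP nu)]_x f x - \int[jordan_neg (hahnP nu)]_x f x.

Definition integral_cmeasure (mu : {charge set T -> \bar R[i]}) (f : T -> R[i]) :
    R[i] :=
  let u x := complex.Re (f x) in
  let v x := complex.Im (f x) in
  ((integral_charge (re_part mu) u - integral_charge (im_part mu) v)
   +i* (integral_charge (re_part mu) v + integral_charge (im_part mu) u))%C.

End complex_integral.

Section torus.
Variables (R : realType) (D : nat).

Definition unit_torus : set 'rV[R[i]^o]_D := [set z | forall a, `|z 0 a| = 1].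

(* [set_type] carries the topology induced by that of C^D. *)
Definition torus_points : Type := set_type unit_torus.
HB.instance Definition _ := Topological.on torus_points.

Lemma unit_torus1 : unit_torus (const_mx 1).
Proof. by move=> a; rewrite mxE normr1. Qed.

HB.instance Definition _ :=
  isPointed.Build torus_points (SigSub (mem_set unit_torus1)).

Definition torus := g_sigma_algebraType (@open torus_points).
HB.instance Definition _ := Measurable.on torus.

Definition torus_point (t : torus) : 'rV[R[i]]_D := set_val (t : torus_points).

End torus.

Section multi_indices.
Variable D : nat.

Definition longitude (al : 'rV[int]_D) : nat := (\sum_a `|al 0%R a|)%N.

Definition lex_le (al be : 'rV[int]_D) : bool :=
  ([tuple al 0 a | a < D] <= [tuple be 0 a | a < D]
     :> D.-tuplelexi int)%O.

(* [k]: multi-indices of longitude k, whose entries all lie in [-k, k]. *)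
Definition layer (k : nat) : seq 'rV[int]_D :=
  sort lex_le
    [seq al <- [seq \row_a ((f a)%:Z - k%:Z) | f : {ffun 'I_D -> 'I_(k.*2.+1)}]
    | longitude al == k].

Definition layer_size (k : nat) : nat := size (layer k).

Definition mindex (k : nat) (i : 'I_(layer_size k)) : 'rV[int]_D := (layer k)`_i.

Lemma mem_layer k al : (al \in layer k) = (longitude al == k).
Proof.
rewrite mem_sort mem_filter; case: eqP => //= alk; apply/mapP.
have lek a : (`|al 0%R a| <= k)%N.
  by rewrite -alk /longitude (bigD1 a)//= leq_addr.
have ltk a : (absz (al 0 a + k%:Z)%R < k.*2.+1)%N by have := lek a; lia.
exists [ffun a => Ordinal (ltk a)]; first by rewrite mem_enum.
apply/rowP => a; rewrite mxE ffunE; move: (lek a).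
rewrite [val _]/=; move: (al 0 a : int) => x; lia.
Qed.

Lemma layer_uniq k : uniq (layer k).
Proof.
rewrite sort_uniq filter_uniq// map_inj_uniq ?enum_uniq// => f g.
move=> /rowP fg; apply/ffunP => a; apply/val_inj.
by have := fg a; rewrite !mxE => /addIr[].
Qed.

Lemma layer_sorted k : sorted lex_le (layer k).
Proof. by apply: sort_sorted => al be; exact: le_total. Qed.

Definition unit_index (a : 'I_D) : 'rV[int]_D := delta_mx 0 a.

End multi_indices.

Section semi_infinite.
Variables (C : numClosedFieldType) (D : nat).
Local Notation N := (@layer_size D).

(* Semi-infinite matrices and columns, given by their blocks A_{[k],[l]} and
   v_{[k]}. *)
Definition bmatrix := forall k l, 'M[C]_(N k, N l).
Definition bcolumn := forall k, 'cV[C]_(N k).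

(* The sums over the block index are finite in every product formed below. *)
Definition bmul (A B : bmatrix) : bmatrix :=
  fun k l => \sum_(j \in [set: nat]) A k j *m B j l.
Definition bapply (A : bmatrix) (v : bcolumn) : bcolumn :=
  fun k => \sum_(j \in [set: nat]) A k j *m v j.

Definition bone : bmatrix :=
  fun k l => \matrix_(i, j) (mindex i == mindex j)%:R.
Definition btr (A : bmatrix) : bmatrix := fun k l => (A l k)^T.
Definition badj (A : bmatrix) : bmatrix := fun k l => (A l k)^t*.
Definition bconj (A : bmatrix) : bmatrix := fun k l => map_mx Num.conj (A k l).

Definition is_binv (A B : bmatrix) : Prop := bmul A B = bone /\ bmul B A = bone.

Definition truncation (A : bmatrix) (k : nat) : 'M[C]_(\sum_(i < k) N i) :=
  \mxblock_(i < k, j < k) A i j.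

Definition block_lower_unitriangular (A : bmatrix) : Prop :=
  (forall k l, (k < l)%N -> A k l = 0) /\ (forall k, A k k = 1%:M).

Definition block_diagonal (A : bmatrix) : Prop := forall k l, k != l -> A k l = 0.

(* G = S^-1 H (Sh^-1)^dagger *)
Definition gauss_factorization (G S H Sh : bmatrix) : Prop :=
  [/\ block_lower_unitriangular S, block_lower_unitriangular Sh,
      block_diagonal H, (forall k, H k k \in unitmx)
    & exists Si Shi : bmatrix,
        [/\ is_binv S Si, is_binv Sh Shi & G = bmul (bmul Si H) (badj Shi)]].

Definition spectral (a : 'I_D) : bmatrix :=
  fun k l => \matrix_(i, j) (mindex i + unit_index a == mindex j)%:R.

Definition reversal : bmatrix :=
  fun k l => \matrix_(i, j) (mindex i == - mindex j)%:R.

(* n = (n_{-1}, ..., n_{-D}, n_D, ..., n_1)^T *)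
Definition coef_neg (n : 'cV[C]_(D + D)) (a : 'I_D) : C := n (lshift D a) 0.
Definition coef_pos (n : 'cV[C]_(D + D)) (a : 'I_D) : C :=
  n (rshift D (rev_ord a)) 0.

Definition Lpoly (n : 'cV[C]_(D + D)) (z : 'rV[C]_D) : C :=
  \sum_a (coef_neg n a * (z 0 a)^-1 + coef_pos n a * z 0 a).

(* The inverse of [spectral a] is its transpose. *)
Definition Lspectral (n : 'cV[C]_(D + D)) : bmatrix := fun k l =>
  \sum_a (coef_neg n a *: btr (spectral a) k l + coef_pos n a *: spectral a k l).

Definition monomial (al : 'rV[int]_D) (z : 'rV[C]_D) : C :=
  \prod_a z 0 a ^ al 0 a.

Definition monomials (z : 'rV[C]_D) : bcolumn :=
  fun k => \col_i monomial (mindex i) z.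

Definition vinv (z : 'rV[C]_D) : 'rV[C]_D := map_mx (fun x => x^-1) z.
Definition vconj_inv (z : 'rV[C]_D) : 'rV[C]_D := map_mx (fun x => (x^*)^-1) z.

End semi_infinite.

Section moments.
Variables (R : realType) (D : nat).

Definition moment_matrix (mu : {charge set (torus R D) -> \bar R[i]}) :
    bmatrix R[i] D :=
  fun k l => \matrix_(i, j) integral_cmeasure mu (fun t : torus R D =>
    (monomials (torus_point t) k *m (monomials (torus_point t) l)^t*) i j).

Definition quasi_definite (mu : {charge set (torus R D) -> \bar R[i]}) : Prop :=
  forall k, (1 <= k)%N -> \det (truncation (moment_matrix mu) k) != 0.

End moments.

Definition christoffel_darboux (C : numClosedFieldType) (D : nat)
    (S H Sh : bmatrix C D) (k : nat) (z1 z2 : 'rV[C]_D) : C :=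
  (\sum_(l < k) (bapply Sh (monomials z1) l)^t* *m invmx (H l l)
     *m bapply S (monomials z2) l) 0 0.

(* Main.v *)
(* Put T = conj Sh, so that G = S^-1 H T^-T.  On the torus the moments depend only
   on the difference of the multi-indices; hence nu commutes with G and
   eta G eta = G^T.  The first property gives J H = H J'^T for the Jacobi matrices
   J = S nu S^-1 and J' = T nu^T T^-1, so J is block tridiagonal.  Since phi(z2) is
   an eigenvector of J and H^-T T chi(conj z1) one of J^T, the first formula is
   summation by parts.  The second property and the uniqueness of the block
   factorization give eta S eta = T and eta H eta = H^T, which turn the first
   formula into the other two. *)

Require Import Defs.
From HB Require Import structures.
From mathcomp Require Import all_boot all_order all_algebra.
From mathcomp Require Import complex zify.
From mathcomp Require Import all_classical all_reals all_analysis.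

Set Implicit Arguments.
Unset Strict Implicit.
Unset Printing Implicit Defensive.

Import Order.TTheory GRing.Theory Num.Theory.
Import numFieldNormedType.Exports.

Local Open Scope ring_scope.
Local Open Scope sesquilinear_scope.

(** * Semi-infinite block matrices with finitely many superdiagonals *)

Section band_matrices.
Variables (C : numClosedFieldType) (D : nat).
Implicit Types (A B E : bmatrix C D) (v w : bcolumn C D) (p q k l m : nat).
Local Notation N := (@layer_size D).
Local Notation one := (bone C D).

(** At most [p] block superdiagonals are nonzero, so every block row is finite; [lower 0] is block
    lower triangularity. Finiteness of the columns of [A] is expressed as [lower q (btr A)]. *)
Definition lower p A := forall k l, (k + p < l)%N -> A k l = 0.

Lemma bmatrixP A B : (forall k l, A k l = B k l) -> A = B.
Proof.
move=> AB; apply: functional_extensionality_dep => k.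
exact: functional_extensionality_dep.
Qed.

Lemma bcolumnP v w : (forall k, v k = w k) -> v = w.
Proof. by move=> vw; apply: functional_extensionality_dep. Qed.

(** A sum over all of [nat] defaults to 0 on infinite support; a bound on the support makes it an
    ordinary finite sum. *)
Lemma fsum_ord (V : nmodType) (F : nat -> V) m :
    (forall j, (m <= j)%N -> F j = 0) ->
  \sum_(j \in [set: nat]) F j = \sum_(j < m) F j.
Proof.
move=> F0; rewrite fsbig_ord; apply/esym/fsbig_widen => // j [_ /= /negP].
by rewrite -leqNgt => /F0.
Qed.

Lemma bmul_lower p A B k l m : lower p A -> (k + p < m)%N ->
  bmul A B k l = \sum_(j < m) A k j *m B j l.
Proof.
move=> Ap km; apply: fsum_ord => j mj.
by rewrite Ap ?mul0mx//; apply: leq_trans mj.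
Qed.

Lemma bmul_upper p A B k l m : lower p (btr B) -> (l + p < m)%N ->
  bmul A B k l = \sum_(j < m) A k j *m B j l.
Proof.
move=> Bp lm; apply: fsum_ord => j mj.
by rewrite -[B j l]trmxK [(B j l)^T]Bp ?trmx0 ?mulmx0//; apply: leq_trans mj.
Qed.

Lemma bapply_lower p A v k m : lower p A -> (k + p < m)%N ->
  bapply A v k = \sum_(j < m) A k j *m v j.
Proof.
move=> Ap km; apply: fsum_ord => j mj.
by rewrite Ap ?mul0mx//; apply: leq_trans mj.
Qed.

Lemma btrK A : btr (btr A) = A.
Proof. by apply: bmatrixP => k l; rewrite /btr trmxK. Qed.

Lemma btr_bmul p A B : lower p A -> btr (bmul A B) = bmul (btr B) (btr A).
Proof.
move=> Ap; apply: bmatrixP => k l.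
rewrite /btr (bmul_lower _ _ Ap (ltnSn _)).
rewrite (@bmul_upper p _ (btr A) _ _ (l + p).+1) ?btrK ?ltnSn//.
by rewrite linear_sum/=; apply: eq_bigr => j _; rewrite trmx_mul.
Qed.

Lemma lower_bmul p q A B : lower p A -> lower q B -> lower (p + q) (bmul A B).
Proof.
move=> Ap Bq k l; rewrite addnA => kl.
rewrite (bmul_lower _ _ Ap (ltnSn _)); apply: big1 => j _.
rewrite Bq ?mulmx0//; apply: leq_ltn_trans kl.
by rewrite leq_add2r -ltnS.
Qed.

(** For [j < m] the block [B j l] is outside the band of [B], and for [j > m] the block [A k j] is
    outside the band of [A]; only [j = m] is left. *)
Lemma bmul_corner p q A B k l m : lower p A -> lower q B ->
  m = (k + p)%N -> l = (m + q)%N -> bmul A B k l = A k m *m B m l.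
Proof.
move=> Ap Bq -> ->; rewrite (bmul_lower _ _ Ap (ltnSn _)).
rewrite big_ord_recr/= big1 ?add0r//= => j _.
by rewrite Bq ?mulmx0// ltn_add2r.
Qed.

(** Products of semi-infinite matrices need not associate. Here finite rows of [A] and [B] make the
    double sum finite, with [E] arbitrary. The variants below use finite columns of [B] and [E], or
    finite rows of [A] with finite columns of [E]; the last one admits a full middle factor, such as
    a moment matrix. *)
Lemma bmulA_lower p q A B E : lower p A -> lower q B ->
  bmul (bmul A B) E = bmul A (bmul B E).
Proof.
move=> Ap Bq; apply: bmatrixP => k l.
rewrite (bmul_lower _ _ (lower_bmul Ap Bq) (ltnSn _)).
rewrite (bmul_lower _ _ Ap (ltnSn _)).
under eq_bigr do rewrite (bmul_lower _ _ Ap (ltnSn _)) mulmx_suml.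
rewrite exchange_big/=; apply: eq_bigr => j _.
rewrite (@bmul_lower q _ _ _ _ (k + (p + q)).+1) ?mulmx_sumr//; last first.
  by rewrite ltnS addnA leq_add2r -ltnS.
by apply: eq_bigr => i _; rewrite mulmxA.
Qed.

Lemma bmulA_upper p q A B E : lower p (btr B) -> lower q (btr E) ->
  bmul (bmul A B) E = bmul A (bmul B E).
Proof.
move=> Bp Eq; apply: bmatrixP => k l.
have BE : lower (q + p) (btr (bmul B E)).
  rewrite -[B]btrK -[E]btrK -(btr_bmul _ Eq) btrK; exact: lower_bmul.
rewrite (bmul_upper _ _ BE (ltnSn _)) (bmul_upper _ _ Eq (ltnSn _)).
under [RHS]eq_bigr do rewrite (bmul_upper _ _ Eq (ltnSn _)) mulmx_sumr.
rewrite exchange_big/=; apply: eq_bigr => j _.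
rewrite (@bmul_upper p _ _ _ _ (l + (q + p)).+1) ?mulmx_suml//; last first.
  by rewrite ltnS addnA leq_add2r -ltnS.
by apply: eq_bigr => i _; rewrite mulmxA.
Qed.

Lemma bmulA_mixed p q A B E : lower p A -> lower q (btr E) ->
  bmul (bmul A B) E = bmul A (bmul B E).
Proof.
move=> Ap Eq; apply: bmatrixP => k l.
rewrite (bmul_lower _ _ Ap (ltnSn _)) (bmul_upper _ _ Eq (ltnSn _)).
under eq_bigr do rewrite (bmul_lower _ _ Ap (ltnSn _)) mulmx_suml.
under [RHS]eq_bigr do rewrite (bmul_upper _ _ Eq (ltnSn _)) mulmx_sumr.
rewrite exchange_big/=; apply: eq_bigr => j _.
by apply: eq_bigr => i _; rewrite mulmxA.
Qed.

Lemma bapply_bmul p q A B v : lower p A -> lower q B ->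
  bapply (bmul A B) v = bapply A (bapply B v).
Proof.
move=> Ap Bq; apply: bcolumnP => k.
rewrite (bapply_lower _ (lower_bmul Ap Bq) (ltnSn _)).
rewrite (bapply_lower _ Ap (ltnSn _)).
under eq_bigr do rewrite (bmul_lower _ _ Ap (ltnSn _)) mulmx_suml.
rewrite exchange_big/=; apply: eq_bigr => j _.
rewrite (@bapply_lower q _ _ _ (k + (p + q)).+1) ?mulmx_sumr//; last first.
  by rewrite ltnS addnA leq_add2r -ltnS.
by apply: eq_bigr => i _; rewrite mulmxA.
Qed.

(** * Identity, block diagonal and block unitriangular matrices *)

Lemma bone_diag k : one k k = 1%:M.
Proof.
apply/matrixP => i j; rewrite !mxE /mindex nth_uniq ?layer_uniq//.
Qed.

Lemma mindex_longitude k (i : 'I_(N k)) : longitude (mindex i) = k.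
Proof. by apply/eqP; rewrite -mem_layer mem_nth. Qed.

Lemma bone_off k l : k != l -> one k l = 0.
Proof.
move=> kl; apply/matrixP => i j; rewrite !mxE; case: eqP => //= ij.
by move: kl; rewrite -(mindex_longitude i) ij mindex_longitude eqxx.
Qed.

Lemma block_diagonal_lower A : block_diagonal A -> lower 0 A.
Proof. by move=> dA k l; rewrite addn0 => kl; apply: dA; rewrite neq_ltn kl. Qed.

Lemma btr_block_diagonal A : block_diagonal A -> block_diagonal (btr A).
Proof. by move=> dA k l kl; rewrite /btr dA ?trmx0// eq_sym. Qed.

Lemma bmul_diagl A B k l : block_diagonal A -> bmul A B k l = A k k *m B k l.
Proof.
move=> dA; rewrite (bmul_lower _ _ (block_diagonal_lower dA) (ltnSn _)) addn0.
rewrite big_ord_recr/= big1 ?add0r//= => j _.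
by rewrite dA ?mul0mx// neq_ltn ltn_ord orbT.
Qed.

Lemma bmul_diagr A B k l : block_diagonal B -> bmul A B k l = A k l *m B l l.
Proof.
move=> dB; have dBt := block_diagonal_lower (btr_block_diagonal dB).
rewrite (bmul_upper _ _ dBt (ltnSn _)) addn0.
rewrite big_ord_recr/= big1 ?add0r//= => j _.
by rewrite dB ?mulmx0// neq_ltn ltn_ord.
Qed.

Lemma bone_block_diagonal : block_diagonal one.
Proof. exact: bone_off. Qed.

Lemma bmul1 A : bmul A one = A.
Proof.
apply: bmatrixP => k l.
by rewrite bmul_diagr ?bone_diag ?mulmx1//; exact: bone_block_diagonal.
Qed.

Lemma b1mul A : bmul one A = A.
Proof.
apply: bmatrixP => k l.
by rewrite bmul_diagl ?bone_diag ?mul1mx//; exact: bone_block_diagonal.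
Qed.

Lemma btr_bone : btr one = one.
Proof.
apply: bmatrixP => k l; apply/matrixP => i j.
by rewrite !mxE eq_sym.
Qed.

Lemma bapply1 v : bapply one v = v.
Proof.
have one_lower := block_diagonal_lower bone_block_diagonal.
apply: bcolumnP => k; rewrite (bapply_lower _ one_lower (ltnSn _)) addn0.
rewrite big_ord_recr/= big1 ?add0r/= ?bone_diag ?mul1mx// => j _.
by rewrite bone_off ?mul0mx// neq_ltn ltn_ord orbT.
Qed.

Lemma unitriangular_lower A : block_lower_unitriangular A -> lower 0 A.
Proof. by case=> A0 _ k l; rewrite addn0; apply: A0. Qed.

Lemma unitriangular_bmul A B :
  block_lower_unitriangular A -> block_lower_unitriangular B ->
  block_lower_unitriangular (bmul A B).
Proof.
move=> uA uB; have [lA lB] := (unitriangular_lower uA, unitriangular_lower uB).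
split=> [k l kl|k]; first by apply: (lower_bmul lA lB); rewrite !addn0.
by rewrite (bmul_corner (m := k) lA lB) ?addn0// uA.2 uB.2 mulmx1.
Qed.

(** Forward substitution: the diagonal blocks of [A] being identities, row [k] of the equation gives
    row [k] of [B] from the earlier rows, and the shape of [B] follows by strong induction on
    [k]. *)
Lemma unitriangular_binv A B :
  block_lower_unitriangular A -> bmul A B = one -> block_lower_unitriangular B.
Proof.
move=> uA AB.
have E k l : B k l = one k l - \sum_(j < k) A k j *m B j l.
  rewrite -AB (bmul_lower _ _ (unitriangular_lower uA) (ltnSn _)) addn0.
  by rewrite big_ord_recr/= uA.2 mul1mx [_ + B k l]addrC addrK.
have B0 k l : (k < l)%N -> B k l = 0.
  elim/ltn_ind: k l => k IH l kl; rewrite E bone_off ?neq_ltn ?kl//.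
  rewrite big1 ?subrr// => j _; rewrite IH ?mulmx0//.
  exact: ltn_trans kl.
split=> // k; rewrite E bone_diag big1 ?subr0// => j _.
by rewrite B0 ?mulmx0.
Qed.

End band_matrices.

(** * Shift matrices acting on functions of a multi-index *)

Section shifts_and_reversal.
Variables (C : numClosedFieldType) (D : nat).
Implicit Types (A B : bmatrix C D) (cn cp : 'I_D -> C) (k l m p : nat).
Implicit Types (al be : 'rV[int]_D) (z : 'rV[C]_D).
Local Notation N := (@layer_size D).

Lemma longitudeD al be : (longitude (al + be) <= longitude al + longitude be)%N.
Proof.
rewrite /longitude -big_split/=; apply: leq_sum => a _; rewrite mxE.
by move: (al 0 a : int) (be 0 a : int) => x y; lia.
Qed.

Lemma longitudeN al : longitude (- al) = longitude al.
Proof. by apply: eq_bigr => a _; rewrite mxE abszN. Qed.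

Lemma longitude_unit_index (a : 'I_D) : longitude (unit_index a) = 1%N.
Proof.
rewrite /longitude (bigD1 a)//= mxE !eqxx big1//= => b ba.
by rewrite mxE (negbTE ba).
Qed.

Lemma longitude_shift al (a : 'I_D) :
  (longitude (al + unit_index a)%R <= (longitude al).+1)%N /\
  (longitude (al - unit_index a)%R <= (longitude al).+1)%N.
Proof.
have := longitudeD al (unit_index a); have := longitudeD al (- unit_index a).
by rewrite longitudeN longitude_unit_index addn1.
Qed.

(** The layer lists each multi-index of longitude [j] exactly once, so the Kronecker delta selects
    one term or none. *)
Lemma sum_layer be j (F : 'rV[int]_D -> C) :
  \sum_(i < N j) (be == mindex i)%:R * F (mindex i) =
  if longitude be == j then F be else 0.
Proof.
case: eqP => [bej|bej]; last first.
  apply: big1 => i _; case: eqP => [bei|_]; last by rewrite mul0r.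
  by case: bej; rewrite bei mindex_longitude.
have lbe : be \in layer D j by rewrite mem_layer bej.
have ltbe : (index be (layer D j) < N j)%N by rewrite index_mem.
have bei : mindex (Ordinal ltbe) = be by rewrite /mindex nth_index.
rewrite (bigD1 (Ordinal ltbe))//= bei eqxx mul1r big1 ?addr0// => i ii.
case: eqP => [bei'|_]; last by rewrite mul0r.
case/eqP: ii; apply: val_inj => /=.
by rewrite bei' /mindex index_uniq ?layer_uniq.
Qed.

Lemma sum_layers be m (F : 'rV[int]_D -> C) : (longitude be < m)%N ->
  \sum_(j < m) \sum_(i < N j) (be == mindex i)%:R * F (mindex i) = F be.
Proof.
move=> bem; under eq_bigr do rewrite sum_layer.
rewrite (bigD1 (Ordinal bem))//= eqxx big1 ?addr0// => j jbe.
by rewrite ifN// eq_sym; apply: contraNneq jbe => jbe; apply/eqP/val_inj.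
Qed.

(** With separate coefficient families, transposition just swaps [cn] and [cp]. For [coef_neg n] and
    [coef_pos n] this is [Lspectral n], and [shift_symbol] is [Lpoly n]. *)
Definition shift_comb cn cp : bmatrix C D := fun k l =>
  \sum_a (cn a *: btr (spectral C a) k l + cp a *: spectral C a k l).

Definition shift_symbol cn cp z : C :=
  \sum_a (cn a * (z 0 a)^-1 + cp a * z 0 a).

Lemma btr_shift_comb cn cp : btr (shift_comb cn cp) = shift_comb cp cn.
Proof.
apply: bmatrixP => k l; rewrite /btr /shift_comb linear_sum/=.
by apply: eq_bigr => a _; rewrite linearD/= !linearZ/= /btr trmxK addrC.
Qed.

Lemma shift_combE cn cp k l i j : shift_comb cn cp k l i j =
  \sum_a (cn a * (mindex i - unit_index a == mindex j)%:R
          + cp a * (mindex i + unit_index a == mindex j)%:R).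
Proof.
rewrite summxE; apply: eq_bigr => a _; rewrite !mxE subr_eq.
by congr (_ * _%:R + _); rewrite eq_sym.
Qed.

Lemma shift_comb_lower cn cp : lower 1 (shift_comb cn cp).
Proof.
move=> k l kl; apply/matrixP => i j; rewrite shift_combE mxE big1// => a _.
have [lp ln] := longitude_shift (mindex i) a; move: lp ln.
have neq al : (longitude al <= k.+1)%N -> (al == mindex j) = false.
  move=> alk; apply/negP => /eqP alj.
  by move: alk; rewrite alj mindex_longitude leqNgt -addn1 kl.
by rewrite mindex_longitude => /neq-> /neq->; rewrite !mulr0 addr0.
Qed.

(** On functions of a multi-index, [shift_comb] is a weighted sum over the neighbours at distance
    one. Neighbours of layer [k] lie in layers up to [k.+1], so a cutoff [m] beyond [k.+1] loses
    nothing. *)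
Lemma shift_comb_mul cn cp k m p (F : 'rV[int]_D -> 'I_p -> C) :
    (k.+1 < m)%N ->
  \sum_(j < m) shift_comb cn cp k j *m (\matrix_(i, q) F (mindex i) q) =
  \matrix_(i, q) \sum_a (cn a * F (mindex i - unit_index a) q
                         + cp a * F (mindex i + unit_index a) q).
Proof.
move=> km; apply/matrixP => i q; rewrite summxE mxE.
transitivity (\sum_(j < m) \sum_(r < N j) \sum_a
   (cn a * ((mindex i - unit_index a == mindex r)%:R * F (mindex r) q)
    + cp a * ((mindex i + unit_index a == mindex r)%:R * F (mindex r) q))).
  apply: eq_bigr => j _; rewrite mxE; apply: eq_bigr => r _.
  rewrite shift_combE mulr_suml mxE; apply: eq_bigr => a _.
  by rewrite mulrDl !mulrA.
under eq_bigr do rewrite exchange_big/=.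
rewrite exchange_big/=; apply: eq_bigr => a _.
under eq_bigr do rewrite big_split/= -!mulr_sumr.
rewrite big_split/= -!mulr_sumr.
have [lp ln] := longitude_shift (mindex i) a; move: lp ln.
rewrite mindex_longitude => lp ln.
by rewrite (@sum_layers _ m (F^~ q)) ?(@sum_layers _ m (F^~ q))//;
  apply: leq_ltn_trans km.
Qed.

Lemma monomialD al be z : (forall a, z 0 a != 0) ->
  monomial (al + be) z = monomial al z * monomial be z.
Proof.
move=> z0; rewrite /monomial -big_split; apply: eq_bigr => a _.
by rewrite mxE expfzDr.
Qed.

Lemma monomial_vinv al z : monomial al (vinv z) = monomial (- al) z.
Proof. by apply: eq_bigr => a _; rewrite !mxE exprz_inv. Qed.

Lemma monomial_unit_index (a : 'I_D) z : monomial (unit_index a) z = z 0 a.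
Proof.
rewrite /monomial (bigD1 a)//= mxE !eqxx expr1z big1 ?mulr1// => b ba.
by rewrite mxE (negbTE ba) andbF expr0z.
Qed.

(** Shifting the exponent by a unit vector multiplies the monomial by [z 0 a] or its inverse;
    nonzero coordinates make integer exponents additive. *)
Lemma shift_comb_monomials cn cp z : (forall a, z 0 a != 0) ->
  bapply (shift_comb cn cp) (monomials z) =
  fun k => shift_symbol cn cp z *: monomials z k.
Proof.
move=> z0; apply: bcolumnP => k.
rewrite (bapply_lower _ (@shift_comb_lower cn cp) (ltnSn _)).
rewrite (@shift_comb_mul _ _ _ _ _ (fun al _ => monomial al z)) ?addn1//.
apply/matrixP => i q; rewrite !mxE mulr_suml; apply: eq_bigr => a _.
rewrite !monomialD// monomial_unit_index -monomial_vinv.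
by rewrite monomial_unit_index mxE mulrDl -!mulrA; congr (_ * _ + _ * _); exact: mulrC.
Qed.

(** * Commutation of shifts with Toeplitz matrices *)

Definition toeplitz A := exists g : 'rV[int]_D -> C,
  forall k l i j, A k l i j = g (mindex i - mindex j).

Lemma shift_comb_mull cn cp A (g : 'rV[int]_D -> C) k l i j :
    (forall k l i j, A k l i j = g (mindex i - mindex j)) ->
  bmul (shift_comb cn cp) A k l i j =
  \sum_a (cn a * g (mindex i - mindex j - unit_index a)
          + cp a * g (mindex i - mindex j + unit_index a)).
Proof.
move=> Ag; rewrite (bmul_lower _ _ (@shift_comb_lower cn cp) (ltnSn _)).
have AE m : A m l = \matrix_(r, q) g (mindex r - mindex q).
  by apply/matrixP => r q; rewrite mxE Ag.
under eq_bigr do rewrite AE.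
rewrite (@shift_comb_mul _ _ _ _ _ (fun al q => g (al - mindex q))) ?addn1// mxE.
by apply: eq_bigr => a _ /=; congr (_ * g _ + _ * g _); rewrite addrAC.
Qed.

Lemma shift_comb_toeplitz cn cp A : toeplitz A ->
  bmul (shift_comb cn cp) A = bmul A (shift_comb cn cp).
Proof.
(* The rows of [A] may be infinite, so [A nu] is computed as the transpose of [nu^T A^T], where
   [A^T] is Toeplitz for the function [g (- al)]. *)
move=> [g Ag]; rewrite -[A in RHS]btrK -[X in _ = bmul _ X]btr_shift_comb.
rewrite -(btr_bmul _ (@shift_comb_lower cp cn)).
apply: bmatrixP => k l; apply/matrixP => i j.
rewrite (shift_comb_mull _ _ _ _ Ag) [RHS]mxE.
rewrite (shift_comb_mull _ _ (g := fun al => g (- al))) => [|? ? r s]; last first.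
  by rewrite mxE Ag opprB.
apply: eq_bigr => a _; rewrite [RHS]addrC/=.
by congr (_ * g _ + _ * g _); rewrite opprD opprB ?opprK.
Qed.

(** * Conjugation by the reversal matrix *)

Lemma reversal_block_diagonal : block_diagonal (reversal C D).
Proof.
move=> k l kl; apply/matrixP => i j; rewrite !mxE; case: eqP => // ij.
by move: kl; rewrite -(mindex_longitude i) ij longitudeN mindex_longitude eqxx.
Qed.

Local Notation rev k := (reversal C D k k).

Lemma reversal_mul k p (F : 'rV[int]_D -> 'I_p -> C) :
  rev k *m (\matrix_(i, q) F (mindex i) q) = \matrix_(i, q) F (- mindex i) q.
Proof.
apply/matrixP => i q; rewrite !mxE.
(* The target entry is the value of [sum_layer] at [- mindex i], which again has longitude [k]. *)
rewrite -[RHS](_ : (if longitude (- mindex i) == k then F (- mindex i) q else 0) = _);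
  last by rewrite longitudeN mindex_longitude eqxx.
rewrite -(sum_layer _ _ (F^~ q)); apply: eq_bigr => r _.
by rewrite !mxE eqr_oppLR.
Qed.

Lemma reversal_tr k : (rev k)^T = rev k.
Proof. by apply/matrixP => i j; rewrite !mxE eq_sym eqr_oppLR. Qed.

Lemma reversalK k : rev k *m rev k = 1%:M.
Proof.
rewrite {2}/reversal (@reversal_mul _ _ (fun al q => (al == - mindex q)%:R)).
rewrite -bone_diag; apply/matrixP => i j.
by rewrite !mxE eqr_opp.
Qed.

Lemma reversal_monomials k z : rev k *m monomials z k = monomials (vinv z) k.
Proof.
rewrite (@reversal_mul _ _ (fun al _ => monomial al z)).
by apply/matrixP => i j; rewrite !mxE monomial_vinv.
Qed.

(** This is [eta A eta]: as [eta] is block diagonal, only its diagonal blocks enter. *)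
Definition reversed A : bmatrix C D := fun k l => rev k *m A k l *m rev l.

(** Negating both indices turns [g (al - be)] into [g (be - al)], the transposed entry. *)
Lemma reversed_toeplitz A : toeplitz A -> reversed A = btr A.
Proof.
move=> [g Ag]; apply: bmatrixP => k l; rewrite /reversed /btr.
have -> : A k l = \matrix_(i, q) g (mindex i - mindex q).
  by apply/matrixP => i j; rewrite mxE Ag.
rewrite (@reversal_mul _ _ (fun al q => g (al - mindex q))).
(* Transposing turns the right factor [eta] into a left one, to which [reversal_mul] applies
   again. *)
rewrite -[LHS]trmxK trmx_mul reversal_tr.
have -> : (\matrix_(i, q) g (- mindex i - mindex q))^T =
    \matrix_(q < N l, i < N k) g (- mindex i - mindex q).
  by apply/matrixP => i j; rewrite !mxE.
rewrite (@reversal_mul _ _ (fun al i => g (- mindex i - al))).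
by apply/matrixP => i j; rewrite !mxE Ag opprK addrC.
Qed.

Lemma reversed_bmul p A B : lower p A ->
  reversed (bmul A B) = bmul (reversed A) (reversed B).
Proof.
move=> Ap; have rAp : lower p (reversed A).
  by move=> k l kl; rewrite /reversed Ap// mulmx0 mul0mx.
apply: bmatrixP => k l; rewrite /reversed (bmul_lower _ _ Ap (ltnSn _)).
rewrite (bmul_lower _ _ rAp (ltnSn _)) mulmx_sumr mulmx_suml.
apply: eq_bigr => j _; rewrite /reversed !mulmxA.
by rewrite -(mulmxA _ (rev j) (rev j)) reversalK mulmx1.
Qed.

Lemma reversed_btr A : reversed (btr A) = btr (reversed A).
Proof.
by apply: bmatrixP => k l; rewrite /reversed /btr !trmx_mul !reversal_tr mulmxA.
Qed.

Lemma reversed_bone : reversed (bone C D) = bone C D.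
Proof.
apply: bmatrixP => k l; rewrite /reversed; have [->|kl] := eqVneq k l.
  by rewrite bone_diag mulmx1 reversalK.
by rewrite bone_off// mulmx0 mul0mx.
Qed.

Lemma reversed_unitriangular A :
  block_lower_unitriangular A -> block_lower_unitriangular (reversed A).
Proof.
move=> [A0 A1]; split=> [k l kl|k]; rewrite /reversed.
  by rewrite A0// mulmx0 mul0mx.
by rewrite A1 mulmx1 reversalK.
Qed.

Lemma reversed_block_diagonal A : block_diagonal A -> block_diagonal (reversed A).
Proof. by move=> A0 k l kl; rewrite /reversed A0// mulmx0 mul0mx. Qed.

Lemma reversed_bapply p A z k : lower p A ->
  bapply (reversed A) (monomials z) k = rev k *m bapply A (monomials (vinv z)) k.
Proof.
move=> Ap; have rAp : lower p (reversed A).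
  by move=> i j ij; rewrite /reversed Ap// mulmx0 mul0mx.
rewrite (bapply_lower _ rAp (ltnSn _)) (bapply_lower _ Ap (ltnSn _)) mulmx_sumr.
by apply: eq_bigr => j _; rewrite /reversed -!mulmxA reversal_monomials.
Qed.

End shifts_and_reversal.

(** * Block LDU factorizations and their uniqueness *)

Section factorization.
Variables (C : numClosedFieldType) (D : nat).
Implicit Types (A B S Si H T Ti G J : bmatrix C D) (v w : bcolumn C D).
Implicit Types (cn cp : 'I_D -> C) (k l m p : nat) (z : 'rV[C]_D).

Definition inverse_pair A B :=
  [/\ block_lower_unitriangular A, block_lower_unitriangular B,
      bmul A B = bone C D & bmul B A = bone C D].

(** A transpose in place of the adjoint makes the theory bilinear; the Gauss factorization is the
    case where [T] is the conjugate of [Sh]. *)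
Definition LDU S Si H T Ti G :=
  [/\ inverse_pair S Si, inverse_pair T Ti, block_diagonal H,
      forall k, H k k \in unitmx & G = bmul (bmul Si H) (btr Ti)].

Lemma inverse_pair_lower A B : inverse_pair A B -> lower 0 A /\ lower 0 B.
Proof. by case=> uA uB _ _; split; apply: unitriangular_lower. Qed.

Lemma LDU_mull S Si H T Ti G : LDU S Si H T Ti G -> bmul S G = bmul H (btr Ti).
Proof.
case=> SSi TTi dH _ ->; have [lS lSi] := inverse_pair_lower SSi.
have lSiH := lower_bmul lSi (block_diagonal_lower dH).
rewrite -(bmulA_lower _ lS lSiH) -(bmulA_lower _ lS lSi).
by case: SSi => _ _ -> _; rewrite b1mul.
Qed.

Lemma LDU_mulr S Si H T Ti G : LDU S Si H T Ti G -> bmul G (btr T) = bmul Si H.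
Proof.
case=> SSi TTi dH _ ->; have [lT lTi] := inverse_pair_lower TTi.
rewrite (bmulA_upper (p := 0) (q := 0)) ?btrK// -(btr_bmul _ lT).
by case: TTi => _ _ -> _; rewrite btr_bone bmul1.
Qed.

Lemma LDU_btr S Si H T Ti G : LDU S Si H T Ti G -> LDU T Ti (btr H) S Si (btr G).
Proof.
case=> SSi TTi dH uH ->; split=> // [|k|].
- exact: btr_block_diagonal.
- by rewrite unitmx_tr.
- have [lS lSi] := inverse_pair_lower SSi; have [lT lTi] := inverse_pair_lower TTi.
  have lH := block_diagonal_lower dH; have lHt := block_diagonal_lower (btr_block_diagonal dH).
  rewrite (btr_bmul _ (lower_bmul lSi lH)) btrK (btr_bmul _ lSi).
  by rewrite (bmulA_lower _ lTi lHt).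
Qed.

(* [S1 G T2^T] equals both [(S1 Si2) H2], which is block lower triangular, and
   [H1 (T2 Ti1)^T], which is block upper triangular. *)
Lemma LDU_unique S1 Si1 H1 T1 Ti1 S2 Si2 H2 T2 Ti2 G :
  LDU S1 Si1 H1 T1 Ti1 G -> LDU S2 Si2 H2 T2 Ti2 G -> S1 = S2 /\ H1 = H2.
Proof.
move=> F1 F2; have := LDU_mull F1; have := LDU_mulr F2.
case: F1 => SSi1 TTi1 dH1 uH1 _; case: F2 => SSi2 TTi2 dH2 uH2 _ E2 E1.
have [lS1 lSi1] := inverse_pair_lower SSi1; have [lT1 lTi1] := inverse_pair_lower TTi1.
have [lS2 lSi2] := inverse_pair_lower SSi2; have [lT2 lTi2] := inverse_pair_lower TTi2.
have E : bmul (bmul S1 Si2) H2 = bmul H1 (btr (bmul T2 Ti1)).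
  rewrite (bmulA_lower _ lS1 lSi2) -E2 (btr_bmul _ lT2).
  rewrite -(bmulA_mixed (p := 0) (q := 0)) ?btrK// E1.
  by rewrite (bmulA_upper (p := 0) (q := 0)) ?btrK.
have [uS1 _ _ _] := SSi1; have [_ uSi2 _ Si2S2] := SSi2.
have [uT2 _ _ _] := TTi2; have [_ uTi1 _ _] := TTi1.
have [M0 M1] := unitriangular_bmul uS1 uSi2.
have [W0 W1] := unitriangular_bmul uT2 uTi1.
have Ekl k l : bmul S1 Si2 k l *m H2 l l = H1 k k *m (bmul T2 Ti1 l k)^T.
  by rewrite -(bmul_diagr _ _ _ dH2) E bmul_diagl.
have ME : bmul S1 Si2 = bone C D.
  apply: bmatrixP => k l; have [->|kl] := eqVneq k l; first by rewrite M1 bone_diag.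
  rewrite bone_off//; move: kl; rewrite neq_ltn => /orP[/M0//|lk].
  by rewrite -[LHS](mulmxK (uH2 l)) Ekl W0// trmx0 mulmx0 mul0mx.
split; first by rewrite -[S1]bmul1 -Si2S2 -(bmulA_lower _ lS1 lSi2) ME b1mul.
apply: bmatrixP => k l; have [->|kl] := eqVneq k l; last by rewrite dH1 ?dH2.
by have := Ekl l l; rewrite M1 W1 mul1mx trmx1 mulmx1.
Qed.

Lemma inverse_pair_reversed A B :
  inverse_pair A B -> inverse_pair (reversed A) (reversed B).
Proof.
move=> AB; have [lA lB] := inverse_pair_lower AB; case: AB => uA uB AB BA.
split; try exact: reversed_unitriangular.
- by rewrite -(reversed_bmul _ lA) AB reversed_bone.
- by rewrite -(reversed_bmul _ lB) BA reversed_bone.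
Qed.

Lemma LDU_reversed S Si H T Ti G : LDU S Si H T Ti G ->
  LDU (reversed S) (reversed Si) (reversed H) (reversed T) (reversed Ti)
      (reversed G).
Proof.
case=> SSi TTi dH uH ->; have [lS lSi] := inverse_pair_lower SSi.
have lSiH := lower_bmul lSi (block_diagonal_lower dH).
split; try exact: inverse_pair_reversed.
- exact: reversed_block_diagonal.
- move=> k; have ur : reversal C D k k \in unitmx.
    by have [] := mulmx1_unit (reversalK C D k).
  by rewrite !unitmx_mul ur uH.
- by rewrite (reversed_bmul _ lSiH) (reversed_bmul _ lSi) reversed_btr.
Qed.

(** The matrix [eta G eta = G^T] is factorized in two ways, by reversing the factors of [G] and by
    transposing them; uniqueness identifies the results. *)
Lemma LDU_toeplitz S Si H T Ti G : toeplitz G -> LDU S Si H T Ti G ->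
  reversed S = T /\ reversed H = btr H.
Proof.
move=> tG F; apply: LDU_unique (LDU_btr F).
by rewrite -(reversed_toeplitz tG); apply: LDU_reversed F.
Qed.

(** * Jacobi matrices and the bilinear Christoffel-Darboux formula *)

Lemma bapplyZ p A v (c : C) : lower p A ->
  bapply A (fun k => c *: v k) = fun k => c *: bapply A v k.
Proof.
move=> Ap; apply: bcolumnP => k; rewrite !(bapply_lower _ Ap (ltnSn _)) scaler_sumr.
by apply: eq_bigr => j _; rewrite scalemxAr.
Qed.

Definition jacobi S Si cn cp : bmatrix C D := bmul (bmul S (shift_comb cn cp)) Si.

Lemma jacobi_lower S Si cn cp : inverse_pair S Si -> lower 1 (jacobi S Si cn cp).
Proof.
move=> /inverse_pair_lower[lS lSi].
exact: lower_bmul (lower_bmul lS (@shift_comb_lower C D cn cp)) lSi.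
Qed.

(** On the outermost superdiagonal only corner blocks multiply, and the diagonal blocks of [S] and
    [Si] are identities. This is why blocks of [nu] itself appear in the final formulae. *)
Lemma jacobi_super S Si cn cp k : inverse_pair S Si ->
  jacobi S Si cn cp k k.+1 = shift_comb cn cp k k.+1.
Proof.
move=> SSi; have [lS lSi] := inverse_pair_lower SSi.
have ln := @shift_comb_lower C D cn cp.
rewrite /jacobi (bmul_corner (m := k.+1) (lower_bmul lS ln) lSi) ?addn0 ?addn1//.
rewrite (bmul_corner (m := k) lS ln) ?addn0 ?addn1//.
by case: SSi => -[_ ->] [_ ->] _ _; rewrite mul1mx mulmx1.
Qed.

Lemma jacobi_eigen S Si cn cp z : inverse_pair S Si -> (forall a, z 0 a != 0) ->
  bapply (jacobi S Si cn cp) (bapply S (monomials z)) =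
  fun k => shift_symbol cn cp z *: bapply S (monomials z) k.
Proof.
move=> SSi z0; have [lS lSi] := inverse_pair_lower SSi.
have ln := @shift_comb_lower C D cn cp.
rewrite /jacobi (bapply_bmul _ (lower_bmul lS ln) lSi) -(bapply_bmul _ lSi lS).
case: SSi => _ _ _ ->; rewrite bapply1 (bapply_bmul _ lS ln).
by rewrite shift_comb_monomials// (bapplyZ _ _ lS).
Qed.

Lemma jacobi_adjoint S Si H T Ti G cn cp : toeplitz G -> LDU S Si H T Ti G ->
  bmul (jacobi S Si cn cp) H = bmul H (btr (jacobi T Ti cp cn)).
Proof.
move=> tG F; have SG := LDU_mull F; have GT := LDU_mulr F.
case: F => SSi TTi dH _ _.
have [lS lSi] := inverse_pair_lower SSi; have [lT lTi] := inverse_pair_lower TTi.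
have ln := @shift_comb_lower C D cn cp; have ln' := @shift_comb_lower C D cp cn.
have lTn : lower 1 (bmul T (shift_comb cp cn)) := lower_bmul lT ln'.
have nT : bmul (shift_comb cn cp) (btr T) = btr (bmul T (shift_comb cp cn)).
  by rewrite (btr_bmul _ lT) btr_shift_comb.
(* The chain is [S nu Si H = S nu G T^T = S G nu T^T = H Ti^T nu T^T]. Since [G] need not be banded,
   each regrouping around it relies on the finite rows or columns of its neighbours. *)
rewrite /jacobi (bmulA_lower _ (lower_bmul lS ln) lSi) (bmulA_lower _ lS ln) -GT.
rewrite -(@bmulA_mixed C D 1 0 _ _ (btr T)) ?btrK//.
rewrite (shift_comb_toeplitz _ _ tG).
rewrite (bmulA_upper (p := 1) (q := 0)) ?btrK ?btr_shift_comb// nT.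
rewrite -(bmulA_mixed (p := 0) (q := 1)) ?btrK// SG.
rewrite (bmulA_upper (p := 0) (q := 1)) ?btrK//.
by rewrite [in RHS](btr_bmul _ lTn).
Qed.

(* Summation by parts: in the double sums of [w_l^T J_{lj} v_j] only the terms
   across the cut between the blocks [k] and [k.+1] survive. *)
Lemma tridiagonal_christoffel_darboux J v w (a b : C) k :
    lower 1 J -> lower 1 (btr J) ->
    bapply J v = (fun l => a *: v l) -> bapply (btr J) w = (fun l => b *: w l) ->
  (a - b) *: \sum_(l < k.+1) (w l)^T *m v l =
  (w k)^T *m J k k.+1 *m v k.+1 - (w k.+1)^T *m J k.+1 k *m v k.
Proof.
move=> lJ lJt Jv Jw; pose f l j := (w l)^T *m J l j *m v j.
(* For [l <= k], row [l] and column [l] of [J] both end by block [k.+1], so the cutoff [k.+2] serves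
   both expansions. *)
have lt_cut (l : 'I_k.+1) : (l + 1 < k.+2)%N by rewrite addn1 !ltnS leq_ord.
have fa : forall l : 'I_k.+1, a *: ((w l)^T *m v l) = \sum_(j < k.+2) f l j.
  move=> l.
  rewrite scalemxAr -[a *: v l]/((fun l => a *: v l) l) -Jv.
  rewrite (bapply_lower _ lJ (lt_cut l)).
  by rewrite mulmx_sumr; apply: eq_bigr => j _; rewrite mulmxA.
have fb : forall l : 'I_k.+1, b *: ((w l)^T *m v l) = \sum_(j < k.+2) f j l.
  move=> l.
  rewrite scalemxAl -linearZ/= -[b *: w l]/((fun l => b *: w l) l) -Jw.
  rewrite (bapply_lower _ lJt (lt_cut l)).
  rewrite linear_sum mulmx_suml; apply: eq_bigr => j _.
  by rewrite /= trmx_mul /btr trmxK.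
rewrite scalerBl !scaler_sumr.
under eq_bigr do rewrite fa; under [X in _ - X]eq_bigr do rewrite fb.
under eq_bigr do rewrite big_ord_recr/=.
under [X in _ - X]eq_bigr do rewrite big_ord_recr/=.
rewrite !big_split/= [X in _ - (X + _)]exchange_big/= opprD addrACA subrr add0r.
rewrite !big_ord_recr/= !big1 ?add0r// => j _.
- by rewrite /f -[J k.+1 j]trmxK [(J _ _)^T]lJt ?trmx0 ?mulmx0 ?mul0mx// addn1 ltnS.
- by rewrite /f lJ ?mulmx0 ?mul0mx// addn1 ltnS.
Qed.

Lemma LDU_christoffel_darboux S Si H T Ti G cn cp k (x1 x2 : 'rV[C]_D) :
    toeplitz G -> LDU S Si H T Ti G ->
    (forall a, x1 0 a != 0) -> (forall a, x2 0 a != 0) ->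
  let u l := bapply T (monomials x1) l in
  let v l := bapply S (monomials x2) l in
  let nu := shift_comb cn cp in
  (shift_symbol cn cp x2 - shift_symbol cp cn x1) *:
    \sum_(l < k.+1) (u l)^T *m invmx (H l l) *m v l =
  (u k)^T *m invmx (H k k) *m nu k k.+1 *m v k.+1
  - (u k.+1)^T *m nu k.+1 k *m invmx (H k k) *m v k.
Proof.
move=> tG F x10 x20 u v nu.
have adj := jacobi_adjoint cn cp tG F.
case: F => SSi TTi dH uH _.
have JE i j : jacobi S Si cn cp i j =
    H i i *m (jacobi T Ti cp cn j i)^T *m invmx (H j j).
  by rewrite -[LHS](mulmxK (uH j)) -(bmul_diagr _ _ _ dH) adj bmul_diagl.
(* The inverse of [H] is absorbed into the left vector, which makes it an eigenvector of the
   transposed Jacobi matrix. *)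
pose w l := (invmx (H l l))^T *m u l.
have wE l : (w l)^T = (u l)^T *m invmx (H l l) by rewrite trmx_mul trmxK.
have lJt : lower 1 (btr (jacobi S Si cn cp)).
  move=> i j ij; rewrite /btr JE [jacobi T Ti cp cn i j]jacobi_lower//.
  by rewrite trmx0 mulmx0 mul0mx trmx0.
have Jw : bapply (btr (jacobi S Si cn cp)) w =
    fun l => shift_symbol cp cn x1 *: w l.
  apply: bcolumnP => l; rewrite (bapply_lower _ lJt (ltnSn _)) /w scalemxAr.
  have <- := congr1 (@^~ l) (jacobi_eigen cp cn TTi x10).
  rewrite (bapply_lower _ (jacobi_lower cp cn TTi) (ltnSn _)) mulmx_sumr.
  apply: eq_bigr => j _; rewrite /btr JE !trmx_mul trmxK -!mulmxA.
  by rewrite trmx_inv mulKVmx ?unitmx_tr.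
have := tridiagonal_christoffel_darboux k (jacobi_lower cn cp SSi)
  lJt (jacobi_eigen cn cp SSi x20) Jw.
under eq_bigr do rewrite wE.
(* By [JE] the subdiagonal block of [J] is a superdiagonal block for [T], transposed, between
   [H k.+1 k.+1] and the inverse of [H k k]; the former cancels the inverse contained in
   [w k.+1]. *)
rewrite (jacobi_super _ _ _ SSi) JE (jacobi_super _ _ _ TTi) !wE => ->.
rewrite -[(shift_comb cp cn k k.+1)^T]/(btr (shift_comb cp cn) k.+1 k).
by rewrite btr_shift_comb !mulmxA mulmxKV.
Qed.

(** * Complex conjugation and reduction to the bilinear setting *)

Lemma bconj_bmul p A B : lower p A -> bconj (bmul A B) = bmul (bconj A) (bconj B).
Proof.
move=> Ap; have cAp : lower p (bconj A).
  by move=> k l kl; rewrite /bconj Ap// map_mx0.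
apply: bmatrixP => k l.
rewrite /bconj (bmul_lower _ _ Ap (ltnSn _)) (bmul_lower _ _ cAp (ltnSn _)).
by rewrite raddf_sum; apply: eq_bigr => j _; rewrite /= map_mxM.
Qed.

Lemma bconj_unitriangular A :
  block_lower_unitriangular A -> block_lower_unitriangular (bconj A).
Proof.
move=> [A0 A1]; split=> [k l kl|k]; first by rewrite /bconj A0 ?map_mx0.
by rewrite /bconj A1 map_mx1.
Qed.

Lemma bconj_bone : bconj (bone C D) = bone C D.
Proof.
apply: bmatrixP => k l; apply/matrixP => i j.
by rewrite !mxE rmorph_nat.
Qed.

Lemma inverse_pair_binv A B :
  block_lower_unitriangular A -> is_binv A B -> inverse_pair A B.
Proof. by move=> uA [AB BA]; split=> //; apply: unitriangular_binv AB. Qed.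

Lemma inverse_pair_bconj A B :
  inverse_pair A B -> inverse_pair (bconj A) (bconj B).
Proof.
move=> AB; have [lA lB] := inverse_pair_lower AB; case: AB => uA uB AB BA.
split; try exact: bconj_unitriangular.
- by rewrite -(bconj_bmul _ lA) AB bconj_bone.
- by rewrite -(bconj_bmul _ lB) BA bconj_bone.
Qed.

Lemma gauss_factorization_LDU G S H Sh : gauss_factorization G S H Sh ->
  exists Si Ti, LDU S Si H (bconj Sh) Ti G.
Proof.
move=> [uS uSh dH uH [Si [Shi [SSi ShShi ->]]]]; exists Si, (bconj Shi); split=> //.
- exact: inverse_pair_binv.
- exact/inverse_pair_bconj/inverse_pair_binv.
- by congr bmul; apply: bmatrixP => k l; rewrite /badj /btr /bconj map_trmx.
Qed.

(** Conjugation passes through integer powers onto the variables, so the adjoint becomes a transpose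
    at the conjugate point. *)
Lemma bapply_adjoint p A z k : lower p A ->
  (bapply A (monomials z) k)^t* =
  (bapply (bconj A) (monomials (map_mx Num.conj z)) k)^T.
Proof.
move=> Ap; have cAp : lower p (bconj A).
  by move=> i j ij; rewrite /bconj Ap// map_mx0.
rewrite -map_trmx (bapply_lower _ Ap (ltnSn _)) (bapply_lower _ cAp (ltnSn _)).
congr trmx; rewrite raddf_sum; apply: eq_bigr => j _; rewrite /= map_mxM.
congr (_ *m _); apply/matrixP => i q; rewrite !mxE rmorph_prod.
by apply: eq_bigr => a _; rewrite fmorphXz mxE.
Qed.

End factorization.

(** * The moment matrix and the three formulae *)

Lemma moment_matrix_toeplitz (R : realType) (D : nat)
    (mu : {charge set (torus R D) -> \bar R[i]}) : toeplitz (moment_matrix mu).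
Proof.
exists (fun al => integral_cmeasure mu (fun t : torus R D => monomial al (torus_point t))).
move=> k l i j; rewrite mxE; congr integral_cmeasure; apply/funext => t.
have t1 a : `|torus_point t 0 a| = 1 by exact: (set_valP (t : torus_points R D)).
rewrite mxE big_ord1 !mxE monomialD => [|a]; last by rewrite -normr_eq0 t1 oner_eq0.
(* On the torus the conjugate of a coordinate is its inverse, so the conjugated monomial has the
   negated exponent. *)
congr (_ * _); rewrite rmorph_prod; apply: eq_bigr => a _.
by rewrite fmorphXz mxE -exprz_inv invC_norm t1 expr1n invr1 mul1r.
Qed.

Theorem proposition2p32 (R : realType) (D : nat)
    (mu : {charge set (torus R D) -> \bar R[i]})
    (S H Sh : bmatrix R[i] D) (n : 'cV[R[i]]_(D + D)) (k : nat)
    (z1 z2 : 'rV[R[i]]_D) :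
  (1 <= D)%N ->
  quasi_definite mu ->
  gauss_factorization (moment_matrix mu) S H Sh ->
  (1 <= k)%N ->
  (forall a, z1 0 a != 0) ->
  (forall a, z2 0 a != 0) ->
  Lpoly n z2 != Lpoly n (vconj_inv z1) ->
  let phi (l : nat) (z : 'rV[R[i]]_D) := bapply S (monomials z) l in
  let phih (l : nat) (z : 'rV[R[i]]_D) := bapply Sh (monomials z) l in
  let phih_bar (l : nat) (z : 'rV[R[i]]_D) :=
    bapply (bconj Sh) (monomials z) l in
  let nu := Lspectral n in
  let eta := reversal R[i] D in
  let K := christoffel_darboux S H Sh k z1 z2 in
  let dL := Lpoly n z2 - Lpoly n (vconj_inv z1) in
  [/\ K =
        ((phih k.-1 z1)^t* *m invmx (H k.-1 k.-1) *m nu k.-1 k *m phi k z2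
         - (phih k z1)^t* *m nu k k.-1 *m invmx (H k.-1 k.-1)
             *m phi k.-1 z2) 0 0 / dL,
      K =
        ((phi k.-1 (vconj_inv z1))^T *m invmx (H k.-1 k.-1)^T
             *m bmul eta nu k.-1 k *m phi k z2
         - (phi k (vconj_inv z1))^T *m bmul eta nu k k.-1
             *m invmx (H k.-1 k.-1) *m phi k.-1 z2) 0 0 / dL
    & K =
        ((phih k.-1 z1)^t* *m invmx (H k.-1 k.-1) *m bmul nu eta k.-1 k
             *m phih_bar k (vinv z2)
         - (phih k z1)^t* *m bmul nu eta k k.-1 *m invmx (H k.-1 k.-1)^T
             *m phih_bar k.-1 (vinv z2)) 0 0 / dL].
Proof.
(* From here on [k.+1] plays the role of [k] and [k] that of [k.-1]. *)
move=> _ _ /gauss_factorization_LDU[Si [Ti F]]; case: k => // k _ z10 z20 dL0.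
move=> phi phih phih_bar nu eta K dL.
have tG := moment_matrix_toeplitz mu.
have [rS rH] := LDU_toeplitz tG F.
have lS : lower 0 S by case: F => /inverse_pair_lower[].
have lT : lower 0 (bconj Sh) by case: F => _ /inverse_pair_lower[].
have lSh : lower 0 Sh.
  move=> i j /lT Sh0; apply/matrixP => r q; move/matrixP/(_ r q): Sh0.
  by rewrite !mxE => /eqP; rewrite fmorph_eq0 => /eqP.
have uH l : H l l \in unitmx by case: F.
pose x1 := map_mx Num.conj z1; pose u l := bapply (bconj Sh) (monomials x1) l.
have x10 a : x1 0 a != 0 by rewrite mxE fmorph_eq0.
have phihE l : (phih l z1)^t* = (u l)^T by exact: bapply_adjoint lSh.
have x1V : vinv x1 = vconj_inv z1 by apply/rowP => a; rewrite !mxE.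
pose r l := reversal R[i] D l l.
(* Since [T = eta S eta] and [eta] inverts the argument of the monomials, [T] at the conjugate of
   [z1] is [eta] times [S] at the inverse conjugate. *)
have phiE l : phi l (vconj_inv z1) = r l *m u l.
  by rewrite /u -rS (reversed_bapply _ _ lS) mulmxA reversalK mul1mx x1V.
have z2V : vinv (vinv z2) = z2 by apply/rowP => a; rewrite !mxE invrK.
have phih_barE l : phih_bar l (vinv z2) = r l *m phi l z2.
  by rewrite /phih_bar -rS (reversed_bapply _ _ lS) z2V.
have HtE l : invmx (H l l)^T = r l *m invmx (H l l) *m r l.
  have HtX : (H l l)^T *m (r l *m invmx (H l l) *m r l) = 1%:M.
    rewrite -[(H l l)^T]/(btr H l l) -rH /reversed -/(r l) !mulmxA.
    by rewrite -(mulmxA _ (r l) (r l)) reversalK mulmx1 mulmxK ?reversalK.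
  have uHt : (H l l)^T \in unitmx by rewrite unitmx_tr.
  by rewrite -[RHS](mulKmx uHt) HtX mulmx1.
have etanu i j : bmul eta nu i j = r i *m nu i j.
  exact/bmul_diagl/reversal_block_diagonal.
have nueta i j : bmul nu eta i j = nu i j *m r j.
  exact/bmul_diagr/reversal_block_diagonal.
have rr l p (A : 'M[R[i]]_(p, layer_size D l)) : A *m r l *m r l = A.
  by rewrite -mulmxA reversalK mulmx1.
have KE : K = (\sum_(l < k.+1) (u l)^T *m invmx (H l l) *m phi l z2) 0 0.
  rewrite /K /christoffel_darboux.
  by under eq_bigr do rewrite (bapply_adjoint _ _ lSh).
(* Inverting the coordinates exchanges the coefficients of [z_a] and its inverse, which gives the
   eigenvalue of the transposed shift at the conjugate of [z1]. *)
have dLE : dL = shift_symbol (coef_neg n) (coef_pos n) z2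
    - shift_symbol (coef_pos n) (coef_neg n) x1.
  congr (_ - _); apply: eq_bigr => a _.
  by rewrite !mxE invrK addrC.
have CD : K = ((phih k z1)^t* *m invmx (H k k) *m nu k k.+1 *m phi k.+1 z2
    - (phih k.+1 z1)^t* *m nu k.+1 k *m invmx (H k k) *m phi k z2) 0 0 / dL.
  apply: (canRL (mulfK _)); first by rewrite subr_eq0.
  rewrite !phihE -(LDU_christoffel_darboux _ _ k tG F x10 z20) mxE.
  by rewrite KE dLE mulrC.
(* The other two formulae are the first one with factors [eta] inserted: they meet in pairs, and
   [eta] squares to the identity. *)
have phi_nu : (phi k (vconj_inv z1))^T *m invmx (H k k)^T *m bmul eta nu k k.+1
    = (phih k z1)^t* *m invmx (H k k) *m nu k k.+1.
  by rewrite phihE phiE HtE etanu trmx_mul reversal_tr !mulmxA !rr.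
have phiS_nu : (phi k.+1 (vconj_inv z1))^T *m bmul eta nu k.+1 k
    = (phih k.+1 z1)^t* *m nu k.+1 k.
  by rewrite phihE phiE etanu trmx_mul reversal_tr !mulmxA rr.
have nu_phih_bar p (A : 'M[R[i]]_(p, layer_size D k)) :
    A *m bmul nu eta k k.+1 *m phih_bar k.+1 (vinv z2)
    = A *m nu k k.+1 *m phi k.+1 z2.
  by rewrite phih_barE nueta !mulmxA rr.
have nuS_phih_bar p (A : 'M[R[i]]_(p, layer_size D k.+1)) :
    A *m bmul nu eta k.+1 k *m invmx (H k k)^T *m phih_bar k (vinv z2)
    = A *m nu k.+1 k *m invmx (H k k) *m phi k z2.
  by rewrite phih_barE nueta HtE !mulmxA !rr.
clearbody K dL eta nu phih_bar phi phih; rewrite CD [k.+1.-1]/=.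
split; first by [].
- by rewrite phi_nu phiS_nu.
- by rewrite nu_phih_bar nuS_phih_bar.
Qed.
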